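(* For every integer $m\ge1$ and every $n\ge0$, the monic generalized Hermite polynomials with parameter $-m$ satisfy $$H^{[-m]}_n(x)=\sum_{i=0}^m\binom{m}{i}\frac{\lfloor n/2\rfloor!}{(\lfloor n/2\rfloor-i)!}\,H_{n-2i}(x),$$ where $H_n$ are the monic Hermite polynomials and, by convention, $H_j=0$ for $j<0$ (so terms with $i>\lfloor n/2\rfloor$ are zero).
   Context: For a real parameter $\mu$, the generalized monic Hermite polynomials are $$H^{[\mu]}_{2n}(x)=\sum_{k=0}^n\binom{n+\mu-1/2}{n-k}\frac{(-1)^{n-k}n!}{k!}x^{2k},\qquad H^{[\mu]}_{2n+1}(x)=\sum_{k=0}^n\binom{n+\mu+1/2}{n-k}\frac{(-1)^{n-k}n!}{k!}x^{2k+1},$$ with $\binom{a}{k}=a(a-1)\cdots(a-k+1)/k!$. For $\mu=0$ they are the monic Hermite polynomials $H_n=H_n^{[0]}$, orthogonal with respect to $e^{-x^2}dx$ on $\mathbb{R}$. *)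

(* Defs.v *)
From mathcomp Require Import all_boot all_order all_algebra.

Set Implicit Arguments.
Unset Strict Implicit.
Unset Printing Implicit Defensive.

Import Order.TTheory GRing.Theory Num.Theory.
Local Open Scope ring_scope.

Section GeneralizedHermite.
Variable R : realFieldType.

(* a (a - 1) ... (a - k + 1) / k!, for a real upper argument a *)
Definition gbinom (a : R) (k : nat) : R :=
  (\prod_(j < k) (a - j%:R)) / k`!%:R.

Definition genHermite_even (mu : R) (n : nat) : {poly R} :=
  \sum_(k < n.+1)
    (gbinom (n%:R + mu - 1 / 2%:R) (n - k)
       * ((-1) ^+ (n - k) * n`!%:R / k`!%:R)) *: 'X^(2 * k).

Definition genHermite_odd (mu : R) (n : nat) : {poly R} :=
  \sum_(k < n.+1)
    (gbinom (n%:R + mu + 1 / 2%:R) (n - k)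
       * ((-1) ^+ (n - k) * n`!%:R / k`!%:R)) *: 'X^(2 * k + 1).

Definition genHermite (mu : R) (n : nat) : {poly R} :=
  if odd n then genHermite_odd mu n./2 else genHermite_even mu n./2.

(* Indexed by int so as to carry the convention H_j = 0 for j < 0. *)
Definition hermite (j : int) : {poly R} :=
  match j with
  | Posz n => genHermite 0 n
  | Negz _ => 0
  end.

End GeneralizedHermite.

Arguments hermite R j : clear implicits.

(* Main.v *)
Require Import Defs.
From mathcomp Require Import all_boot all_order all_algebra.
From mathcomp Require Import ring zify.

Import Order.TTheory GRing.Theory Num.Theory.
Local Open Scope ring_scope.

(** Pascal's rule for the generalized binomials gives the contiguity relation
    [H^[mu-1]_n = H^[mu]_n + floor(n/2) H^[mu]_(n-2)], in each parity class.
    Iterating it [m] times from [mu = 0] expands like [(1 + S)^m], where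
    [S : H_n |-> floor(n/2) H_(n-2)] is the weighted shift whose powers produce
    falling factorials. *)

Lemma gbinom0 {R : realFieldType} (a : R) : gbinom a 0 = 1.
Proof. by rewrite /gbinom big_ord0 fact0 divr1. Qed.

(** Over a common denominator, with the product of [a - 1 - j] for [j < k] factored out, this is
    [a = (a - 1 - k) + (k + 1)]. *)
Lemma gbinomS {R : realFieldType} (a : R) (k : nat) :
  gbinom a k.+1 = gbinom (a - 1) k.+1 + gbinom (a - 1) k.
Proof.
rewrite /gbinom big_ord_recl big_ord_recr /= subr0.
have -> : \prod_(i < k) (a - (bump 0 i)%:R) = \prod_(j < k) (a - 1 - j%:R).
  by apply: eq_bigr => i _; rewrite /bump add1n -natr1; ring.
have kfn0 : (k`!%:R : R) != 0 by rewrite pnatr_eq0 -lt0n fact_gt0.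
have kSn0 : (k%:R + 1 : R) != 0 by rewrite natr1 pnatr_eq0.
rewrite factS natrM -natr1; field.
by rewrite kfn0 kSn0.
Qed.

(* [e = 0], [a = mu - 1/2] gives [H^[mu]_(2n)]; [e = 1], [a = mu + 1/2] gives
   [H^[mu]_(2n+1)]. *)
Definition laguerreX2 {R : realFieldType} (e : nat) (a : R) (n : nat) :
    {poly R} :=
  \sum_(k < n.+1)
    (gbinom (n%:R + a) (n - k) * ((-1) ^+ (n - k) * n`!%:R / k`!%:R))
      *: 'X^(2 * k + e).

Lemma genHermiteE {R : realFieldType} (mu : R) (n : nat) :
  genHermite mu n =
    laguerreX2 (odd n) ((if odd n then 1 / 2%:R else - (1 / 2%:R)) + mu) n./2.
Proof.
rewrite /genHermite /laguerreX2; case: (odd n); apply: eq_bigr => k _.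
  by rewrite [1 / _ + mu]addrC addrA.
by rewrite addn0 [- _ + mu]addrC addrA.
Qed.

Lemma laguerreX2_contiguous {R : realFieldType} (e : nat) (a : R) (n : nat) :
  laguerreX2 e (a - 1) n
  = laguerreX2 e a n + n%:R *: laguerreX2 e a n.-1.
Proof.
case: n => [|n]; rewrite /laguerreX2 /=.
  by rewrite scale0r addr0 !big_ord1 !gbinom0.
(* The leading terms agree; below them, the extra Pascal term cancels against the lower polynomial,
   whose sign is opposite. *)
rewrite big_ord_recr [X in _ = X + _]big_ord_recr /= subnn !gbinom0.
rewrite addrAC; congr (_ + _).
rewrite scaler_sumr -big_split /=; apply: eq_bigr => k _.
rewrite scalerA -scalerDl; congr (_ *: _).
have -> : (n.+1 - k = (n - k).+1)%N by rewrite subSn // -ltnS.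
rewrite (gbinomS (n.+1%:R + a)) -addrA.
have -> : n.+1%:R + (a - 1) = n%:R + a by rewrite -natr1; ring.
rewrite factS natrM exprS; ring.
Qed.

Lemma laguerreX2_subn {R : realFieldType} (e : nat) (a : R) (m n : nat) :
  laguerreX2 e (a - m%:R) n =
  \sum_(i < m.+1) ('C(m, i)%:R * (n ^_ i)%:R) *: laguerreX2 e a (n - i).
Proof.
elim: m n => [|m IHm] n.
  by rewrite subr0 big_ord1 bin0 ffactn0 mulr1 scale1r subn0.
rewrite -natr1 opprD addrA laguerreX2_contiguous !IHm.
rewrite [RHS]big_ord_recl [in LHS]big_ord_recl /= !bin0 -addrA.
congr (_ + _).
(* Padding with a last term, null since ['C(m, m.+1) = 0], aligns the ranges. *)
have -> : \sum_(i < m) ('C(m, bump 0 i)%:R * (n ^_ (bump 0 i))%:R)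
              *: laguerreX2 e a (n - bump 0 i) =
          \sum_(i < m.+1) ('C(m, i.+1)%:R * (n ^_ i.+1)%:R)
              *: laguerreX2 e a (n - i.+1).
  by rewrite [RHS]big_ord_recr /= bin_small // mul0r scale0r addr0.
(* Pascal's rule in [m] applies because [n * n.-1 ^_ i = n ^_ i.+1]. *)
rewrite scaler_sumr -big_split /=; apply: eq_bigr => i _.
have -> : (n.-1 - i = n - i.+1)%N by lia.
rewrite /bump add1n binS natrD mulrDl scalerDl scalerA ffactnS natrM.
by congr (_ + _ *: _); ring.
Qed.

(** Lowering the degree by [2 * i] preserves parity, so [e] and [a] stay fixed. *)
Lemma hermite_sub2n (R : realFieldType) (n i : nat) : (i <= n./2)%N ->
  hermite R (n%:Z - (2 * i)%:Z) =
    laguerreX2 (odd n) (if odd n then 1 / 2%:R else - (1 / 2%:R)) (n./2 - i).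
Proof.
move=> le_i.
have le_2i : (2 * i <= n)%N by lia.
have -> : n%:Z - (2 * i)%:Z = (n - 2 * i)%N by lia.
rewrite /= genHermiteE addr0 oddB // mul2n odd_double addbF.
by have -> : ((n - i.*2)./2 = n./2 - i)%N by lia.
Qed.

(* When i > n./2 the truncated n./2 - i is harmless: then n - 2 i < 0, so the
   Hermite factor vanishes. *)
Theorem proposition2p16 (R : realFieldType) (m n : nat) (hm : (1 <= m)%N) :
  genHermite (- m%:R : R) n =
  \sum_(i < m.+1)
    ('C(m, i)%:R * (n./2`!%:R / (n./2 - i)`!%:R))
      *: hermite R (n%:Z - (2 * i)%:Z).
Proof.
rewrite genHermiteE laguerreX2_subn; apply: eq_bigr => i _.
have [le_i|lt_i] := leqP i n./2.
  rewrite hermite_sub2n // -(ffact_fact le_i) natrM mulfK //.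
  by rewrite pnatr_eq0 -lt0n fact_gt0.
rewrite ffact_small // mulr0 scale0r.
have -> : n%:Z - (2 * i)%:Z = Negz (2 * i - n).-1 by lia.
by rewrite scaler0.
Qed.
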